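(* Let $T$ be a $T_1$-space. Then $T$ is zero-dimensional if and only if there exists a metric space $(X,d)$ with a $3$-valued metric $d$ such that $T$ is homeomorphic to a closed subspace of the Wijsman hyperspace $2^{(X,d)}$.
   Context: For a metric space $(X,d)$, let $2^X$ denote the set of all non-empty closed subsets of $X$, and for $x\in X$, $F\in 2^X$ let $d(x,F)=\inf\{d(x,y): y\in F\}$. The Wijsman topology $\tau_{w(d)}$ on $2^X$ is the weakest topology making all the functions $F\mapsto d(x,F)$, $x\in X$, continuous (equivalently, the topology of pointwise convergence when $F$ is identified with the distance function $d(\cdot,F)$). The Wijsman hyperspace of $(X,d)$ is $2^{(X,d)}=(2^X,\tau_{w(d)})$. A metric $d$ on $X$ is $3$-valued if the set $d(X\times X)$ has three elements (the value $0$ being counted). A space is zero-dimensional if it has a base consisting of clopen sets. *)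

(* Defs.v *)
From HB Require Import structures.
From mathcomp Require Import all_boot all_order all_algebra.
From mathcomp Require Import all_classical reals topology.

Set Implicit Arguments.
Unset Strict Implicit.
Unset Printing Implicit Defensive.

Import Order.TTheory GRing.Theory Num.Theory.
Import numFieldTopology.Exports.

Local Open Scope classical_set_scope.
Local Open Scope ring_scope.

(* Not the library's [zero_dimensional], which says that distinct points are
   separated by a clopen set; for T1 spaces that condition is strictly weaker
   than having a base of clopen sets. *)
Definition zero_dimensional_space (T : topologicalType) : Prop :=
  exists2 B : set (set T), basis B & forall U, B U -> clopen U.

Definition homeomorphic (S T : topologicalType) : Prop :=
  exists (f : S -> T) (g : T -> S),
    [/\ cancel f g, cancel g f, continuous f & continuous g].

Section wijsman.
Context {R : realType} (X : metricType R).

Definition three_valued : Prop :=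
  ([set mdist p.1 p.2 | p in [set: X * X]] #= `I_3)%card.

Definition dist_set (x : X) (F : set X) : R := inf [set mdist x y | y in F].

Definition nonempty_closed : Type :=
  set_type [set F : set X | closed F /\ F !=set0].

HB.instance Definition _ := Choice.on nonempty_closed.

Definition dist_fun (x : X) (F : nonempty_closed) : R := dist_set x (set_val F).

(* [initial_topology f] is the weakest topology making [f] continuous, and
   [sup_topology] is the supremum of a family of topologies. *)
Definition wijsman : Type :=
  sup_topology (fun x : X => Topological.class (initial_topology (dist_fun x))).

HB.instance Definition _ := Topological.on wijsman.

End wijsman.

(* Main.v *)
(* A 3-valued metric makes every F |-> d(x, F) a continuous function with finite
   range, so preimages of arbitrary sets of reals are clopen; clopen sets
   therefore form a base of the Wijsman hyperspace and of its subspaces.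

   Conversely, let the points of X be the sets of points of T together with the
   families of such sets, with d(U, c) = 1 when U belongs to the clopen cover c
   and all other nonzero distances equal to 2. The point t of T is represented
   by the set F_t of the clopen sets containing t. Then d(U, F_t) is 0 or 2
   according to whether t belongs to the clopen set U, which gives an embedding.
   Its image is closed because d(c, F_t) = 1 for every clopen cover c: this
   passes to a limit F of the F_t and forces F to meet every clopen cover, so
   that the clopen sets outside F miss some point t, and F = F_t. *)
Require Import Defs.
From HB Require Import structures.
From mathcomp Require Import all_boot all_order all_algebra.
From mathcomp Require Import all_classical reals topology.

Set Implicit Arguments.
Unset Strict Implicit.
Unset Printing Implicit Defensive.

Import Order.TTheory GRing.Theory Num.Theory.
Import numFieldTopology.Exports.

Local Open Scope classical_set_scope.
Local Open Scope ring_scope.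

(** * Finite sets of values and clopen bases *)

Lemma finite_set_inf (R : realType) (A : set R) :
  finite_set A -> has_inf A -> A (inf A).
Proof.
move=> finA infA; have clA : closed A.
  apply: (accessible_finite_set_closed.1 _ _ finA).
  exact/hausdorff_accessible/Rhausdorff.
apply: clA => B /nbhs_ballP[e /= e0 eB].
have [a Aa lt_a] := inf_adherent e0 infA.
exists a; split=> //; apply: eB; rewrite /ball /= ltr_distlC lt_a.
by rewrite andbT (lt_le_trans _ (ge_inf infA.2 Aa))// ltrBlDr ltrDl.
Qed.

(** Only the finite set [A] [&] [range f] matters, and finite sets are closed in a T1 space; the
    complement of [A] gives openness. *)
Lemma finite_range_preimage_clopen (T U : topologicalType) (f : T -> U)
    (A : set U) :
  accessible_space U -> finite_set (range f) -> continuous f ->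
  clopen (f @^-1` A).
Proof.
move=> T1 finf cf.
have clpre B : closed (f @^-1` B).
  have -> : f @^-1` B = f @^-1` (B `&` range f).
    by apply/seteqP; split=> [t Bt|t []//]; split=> //; exists t.
  apply: preimage_closed; first by move=> t _; exact: cf.
  apply: (accessible_finite_set_closed.1 T1).
  exact: sub_finite_set (@subIsetr _ _ _) finf.
split=> //; rewrite -[_ @^-1` _]setCK; apply: closed_openC.
exact: (clpre (~` A)).
Qed.

Definition clopen_nbhs (T : topologicalType) (t : T) : set (set T) :=
  [set U | clopen U /\ U t].

Lemma clopen_nbhs_filter (T : topologicalType) (t : T) :
  Filter (filter_from (clopen_nbhs t) id).
Proof.
apply: filter_from_filter; first by exists setT; split=> //; exact: clopenT.
move=> U V [cU Ut] [cV Vt]; exists (U `&` V) => //.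
by split=> //; exact: clopenI.
Qed.

(** This filter form combines with [cvg_sup], so that the Wijsman topology can be treated one
    distance function at a time. *)
Lemma zero_dimensional_spaceP (T : topologicalType) :
  zero_dimensional_space T <->
  forall t : T, filter_from (clopen_nbhs t) id --> t.
Proof.
split=> [[B [_ cvgB] clB] t U|cvgT].
  move=> /cvgB[V [BV Vt] VU]; exists V => //; split=> //; exact: clB.
exists clopen => //; split=> [U []//|t U /cvgT[V [cV Vt] VU]].
by exists V.
Qed.

Lemma zero_dimensional_initial (S : choiceType) (T : topologicalType)
    (f : S -> T) :
  zero_dimensional_space T -> zero_dimensional_space (initial_topology f).
Proof.
move=> /zero_dimensional_spaceP zdT; apply/zero_dimensional_spaceP => s U.
rewrite nbhsE => -[_ [[V oV <-]] Vfs VU].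
have [W [cW Wfs] WV] := zdT (f s) _ (open_nbhs_nbhs (conj oV Vfs)).
exists (f @^-1` W); last by move=> x /WV/VU.
by split=> //; apply: preimage_clopen cW _; exact: initial_continuous.
Qed.

Lemma homeomorphic_zero_dimensional (S T : topologicalType) :
  homeomorphic S T -> zero_dimensional_space T -> zero_dimensional_space S.
Proof.
move=> [f [g [fK gK cf cg]]] /zero_dimensional_spaceP zdT.
apply/zero_dimensional_spaceP => s U Us.
have [V [cV Vfs] VU] : filter_from (clopen_nbhs (f s)) id (g @^-1` U).
  by apply: zdT; apply: cg; rewrite fK.
exists (f @^-1` V); last by move=> x /VU; rewrite /preimage/= fK.
by split=> //; exact: preimage_clopen.
Qed.

Lemma embedding_homeomorphic (S T : topologicalType) (f : S -> T) :
  injective f -> continuous f ->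
  (forall s U, nbhs s U -> exists2 V, nbhs (f s) V & f @^-1` V `<=` U) ->
  homeomorphic S (set_type (range f)).
Proof.
move=> injf cf openf.
pose h s : set_type (range f) := SigSub (mem_set (imageT f s)).
have hE s : set_val (h s) = f s by [].
have surj (y : set_type (range f)) : exists s, h s = y.
  case: y => y yP; have [s _ fs] := set_mem yP.
  by exists s; apply: val_inj.
have [g gK] := choice surj.
have hK : cancel h g.
  by move=> s; apply: injf; rewrite -!hE gK.
exists h, g; split=> //.
- exact: continuous_comp_initial.
- move=> y U; rewrite -[y]gK hK => /openf[V Vfs VU].
  have : nbhs (h (g y)) (set_val @^-1` V) by exact: initial_continuous.
  apply: filterS => z Vz; apply: VU.
  by rewrite /preimage/= -hE gK.
Qed.

(** * The Wijsman hyperspace of a three-valued metric *)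

Section wijsman_topology.
Context {R : realType} (X : metricType R).

Lemma dist_fun_continuous (x : X) :
  continuous (@dist_fun R X x : wijsman X -> R).
Proof.
move=> F U /(@initial_continuous _ _ (@dist_fun R X x)).
have /cvg_sup/(_ x) : nbhs (F : wijsman X) --> F by [].
exact.
Qed.

Lemma continuous_wijsman (T : topologicalType) (f : T -> wijsman X) :
  (forall x, continuous (fun t => dist_fun x (f t))) -> continuous f.
Proof.
move=> cf t; apply/cvg_sup => x.
have := @continuous_comp_initial _ _ _ (@dist_fun R X x) f (cf x) t.
exact.
Qed.

Lemma wijsmanP (F : wijsman X) : closed (set_val F) /\ set_val F !=set0.
Proof. exact: (@set_valP _ [set F : set X | closed F /\ F !=set0] F). Qed.

Lemma dist_fun_le (x : X) (F : wijsman X) (y : X) :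
  set_val F y -> dist_fun x F <= mdist x y.
Proof.
move=> Fy; apply: ge_inf; last by exists y.
by exists 0 => _ [z _ <-]; exact: mdist_ge0.
Qed.

Context (X3 : three_valued X).

Let mdist_finite : finite_set [set mdist p.1 p.2 | p in [set: X * X]].
Proof. by apply/finite_setP; exists 3%N. Qed.

(** The infimum runs over a finite set of values, so it is a minimum. *)
Lemma dist_fun_attained (x : X) (F : wijsman X) :
  exists2 y, set_val F y & dist_fun x F = mdist x y.
Proof.
have [_ [y Fy]] := wijsmanP F.
have [||z Fz dz] := @finite_set_inf R [set mdist x y | y in set_val F].
- by apply: sub_finite_set mdist_finite => _ [z _ <-]; exists (x, z).
- split; first by exists (mdist x y), y.
  by exists 0 => _ [z _ <-]; exact: mdist_ge0.
by exists z.
Qed.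

Lemma dist_fun_preimage_clopen (x : X) (A : set R) :
  clopen (@dist_fun R X x @^-1` A : set (wijsman X)).
Proof.
apply: finite_range_preimage_clopen; last exact: dist_fun_continuous.
  exact/hausdorff_accessible/Rhausdorff.
apply: sub_finite_set mdist_finite => _ [F _ <-].
by have [y _ ->] := dist_fun_attained x F; exists (x, y).
Qed.

Lemma zero_dimensional_wijsman : zero_dimensional_space (wijsman X).
Proof.
apply/zero_dimensional_spaceP => F; apply/cvg_sup.
  exact: clopen_nbhs_filter.
move=> x U; rewrite nbhsE => -[_ [[V oV <-]] VF VU].
exists (@dist_fun R X x @^-1` V) => //.
by split=> //; exact: dist_fun_preimage_clopen.
Qed.

End wijsman_topology.

(** * The metric space built from sets and covers *)

Section cover_graph.
Context (R : realType) (T : topologicalType).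

Definition clopen_cover (c : set (set T)) : Prop :=
  c `<=` clopen /\ forall t, exists2 U, c U & U t.

Definition cover_graph : Type := (set T + set (set T))%type.
HB.instance Definition _ := Choice.on cover_graph.

(** The covering condition sits in the adjacency, so all families can serve as points without a
    subtype; those that are not clopen covers have no neighbour. *)
Definition cover_adj (x y : cover_graph) : bool :=
  match x, y with
  | inl U, inr c | inr c, inl U => `[< clopen_cover c /\ c U >]
  | _, _ => false
  end.

Definition cover_dist (x y : cover_graph) : R :=
  if x == y then 0 else if cover_adj x y then 1 else 2.

Lemma cover_distxx x : cover_dist x x = 0.
Proof. by rewrite /cover_dist eqxx. Qed.

Lemma cover_dist_ge1 x y : x != y -> 1 <= cover_dist x y.
Proof.
by move=> /negPf xy; rewrite /cover_dist xy; case: ifP; rewrite // ler1n.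
Qed.

Lemma cover_dist_le2 x y : cover_dist x y <= 2.
Proof.
by rewrite /cover_dist; case: ifP => // _; case: ifP; rewrite // ler1n.
Qed.

Lemma cover_dist_eq0 x y : cover_dist x y = 0 -> x = y.
Proof.
move=> d0; apply/eqP; apply: contraT => /cover_dist_ge1.
by rewrite d0 ler10.
Qed.

Lemma cover_dist_sym x y : cover_dist x y = cover_dist y x.
Proof. by rewrite /cover_dist eq_sym; case: x; case: y. Qed.

(** Two nonzero distances add up to at least 2, the largest distance. *)
Lemma cover_dist_triangle y x z :
  cover_dist x z <= cover_dist x y + cover_dist y z.
Proof.
have [->|xy] := eqVneq x y; first by rewrite cover_distxx add0r.
have [->|yz] := eqVneq y z; first by rewrite cover_distxx addr0.
by rewrite (le_trans (cover_dist_le2 x z))// (lerD (cover_dist_ge1 xy))//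
  cover_dist_ge1.
Qed.

HB.instance Definition _ := isMetric.Build R cover_graph
  cover_distxx cover_dist_eq0 cover_dist_sym cover_dist_triangle.

Lemma cover_graph_three_valued : three_valued (cover_graph : metricType R).
Proof.
rewrite /three_valued [X in card_eq X _](_ : _ = [set k%:R | k in `I_3]).
  by apply: inj_card_eq => i j _ _ /eqP; rewrite eqr_nat => /eqP.
apply/seteqP; split=> [_ [[x y] _ <-]|_ [k k3 <-]].
  rewrite /mdist/= /cover_dist; case: ifP => _; first by exists 0%N.
  by case: ifP => _; [exists 1%N|exists 2%N].
case: k k3 => [|[|[|//]]] _.
- by exists (inl setT, inl setT) => //; rewrite /= mdistxx.
- exists (inl setT, inr [set setT]) => //.
  rewrite /mdist/= /cover_dist/= ifT//; apply/asboolP; split=> //.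
  by split=> [_ ->|t]; [exact: clopenT|exists setT].
(* Families are never adjacent, and these two differ even when [T] is empty, since [set0] belongs to
   the second. *)
- exists (inr set0, inr setT) => //; rewrite /mdist/= /cover_dist/= ifF//.
  apply/eqP => -[/seteqP[_ /(_ set0)]].
  by apply.
Qed.

(** * Traces of points and the embedding *)

Definition clopen_trace (t : T) : set cover_graph :=
  [set x | if x is inl U then clopen U /\ U t else False].

Lemma clopen_trace_closed t :
  closed (clopen_trace t : set (cover_graph : metricType R)) /\
  clopen_trace t !=set0.
Proof.
split; last by exists (inl setT); split=> //; exact: clopenT.
(* Balls of radius 1 are singletons, so every set is closed. *)
move=> x /(_ _ (nbhsx_ballx x 1 ltr01)) [y [ty]].
rewrite ballEmdist/= => xy1; suff -> : x = y by [].
by apply/eqP; apply: contraLR xy1 => /cover_dist_ge1; rewrite -leNgt.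
Qed.

Definition trace (t : T) : @wijsman R cover_graph :=
  SigSub (mem_set (clopen_trace_closed t)).

Local Notation gdist := (@dist_fun R cover_graph).

Let X3 := cover_graph_three_valued.

(** A trace contains only sets, and two sets are never adjacent, so the value 1 cannot occur. *)
Lemma dist_trace_inl (t : T) (U : set T) :
  gdist (inl U) (trace t) = if `[< clopen U /\ U t >] then 0 else 2.
Proof.
case: ifPn => /asboolP Ut.
  apply/eqP; rewrite eq_le; apply/andP; split.
    by rewrite -(@mdistxx R cover_graph (inl U)) dist_fun_le.
  by have [y _ ->] := dist_fun_attained X3 (inl U) (trace t); exact: mdist_ge0.
have [[V|//] tV ->] := dist_fun_attained X3 (inl U) (trace t).
rewrite /mdist/= /cover_dist ifF//.
by apply/eqP => -[UV]; apply: Ut; rewrite UV.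
Qed.

Lemma dist_trace_inr (t : T) (c : set (set T)) :
  gdist (inr c) (trace t) = if `[< clopen_cover c >] then 1 else 2.
Proof.
have [[V|//] tV dV] := dist_fun_attained X3 (inr c) (trace t).
case: ifPn => /asboolP cc.
  apply/eqP; rewrite eq_le; apply/andP; split; last first.
    by rewrite dV; exact: cover_dist_ge1.
  have [U cU Ut] := cc.2 t.
  apply: le_trans (_ : @mdist R cover_graph (inr c) (inl U) <= _).
    by apply: dist_fun_le; split=> //; exact: cc.1.
  by rewrite /mdist/= /cover_dist/= ifT//; exact/asboolP.
by rewrite dV /mdist/= /cover_dist/= ifF//; apply/asboolP => -[].
Qed.

(** Along [trace] each distance function is locally constant: only a clopen [U] gives a varying one,
    constant on [U] and on its complement. *)
Lemma trace_continuous : continuous trace.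
Proof.
apply: continuous_wijsman => -[U|c] t; apply: cvg_near_cst; last first.
  by apply: nearW => s; rewrite !dist_trace_inr.
have [cU|ncU] := pselect (clopen U); last first.
  by apply: nearW => s; rewrite !dist_trace_inl !asboolF// => -[].
have [Ut|nUt] := pselect (U t).
  have : nbhs t U by apply: open_nbhs_nbhs; split=> //; exact: cU.1.
  by apply: filterS => s Us; rewrite !dist_trace_inl !asboolT.
have : nbhs t (~` U).
  by apply: open_nbhs_nbhs; split=> //; apply: closed_openC; exact: cU.2.
by apply: filterS => s nUs; rewrite !dist_trace_inl !asboolF// => -[].
Qed.

(** As nonzero distances are at least 1, this is non-membership of [x] in [F], phrased through a
    distance function so that closedness is immediate. *)
Definition far (x : cover_graph) : set (@wijsman R cover_graph) :=
  [set F | 1 <= gdist x F].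

Lemma far_closed x : closed (far x).
Proof. exact: (dist_fun_preimage_clopen X3 x [set r | 1 <= r]).2. Qed.

Lemma far_notin x (F : @wijsman R cover_graph) : far x F -> ~ set_val F x.
Proof.
move=> xF Fx; have := le_trans xF (dist_fun_le x Fx).
by rewrite mdistxx ler10.
Qed.

(* The conditions on the complements make F a family of clopen sets that omits
   U or its complement; those on the covers say that F meets every clopen
   cover, so the clopen sets outside F do not cover T. *)
Lemma range_trace : range trace =
  (\bigcap_(c in clopen_cover) [set F | gdist (inr c) F <= 1]) `&`
  (\bigcap_c far (inr c)) `&`
  (\bigcap_(U in clopen) (far (inl U) `|` far (inl (~` U)))) `&`
  (\bigcap_(U in ~` clopen) far (inl U)).
Proof.
apply/seteqP; split=> [_ [t _ <-]|F [[[hit far_cover] far_compl] far_nclopen]].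
  split; [split; [split|]|].
  - by move=> c cc; rewrite /= dist_trace_inr asboolT.
  - by move=> c _; rewrite /far/= dist_trace_inr; case: ifP; rewrite // ler1n.
  - move=> U cU; have [Ut|nUt] := pselect (U t); [right|left];
      by rewrite /far/= dist_trace_inl asboolF ?ler1n// => -[].
  - by move=> U ncU; rewrite /far/= dist_trace_inl asboolF ?ler1n// => -[].
have clopenF U : set_val F (inl U) -> clopen U.
  by move=> FU; apply: contrapT => /far_nclopen/far_notin.
have [t tF] : exists t, forall U, clopen U -> U t -> set_val F (inl U).
  apply: contrapT => nt.
  pose c := [set U | clopen U /\ ~ set_val F (inl U)].
  have cc : clopen_cover c.
    split=> [U []//|t]; apply: contrapT => nU; apply: nt; exists t => U cU Ut.
    by apply: contrapT => nFU; apply: nU; exists U.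
  (* A point [y] of [F] nearest to [c] is not a family, by [far_cover]; a set of [F] lies outside
     [c], hence at distance 2, against [hit]. *)
  have := hit _ cc; have [y Fy /= ->] := dist_fun_attained X3 (inr c) F.
  case: y Fy => [U FU|c' /(far_notin (far_cover c' I))//].
  rewrite /mdist/= /cover_dist/= ifF ?ler_nat//.
  + by rewrite (ler_nat R 2 1).
  + by apply/asboolP => -[_ []].
exists t => //; apply: val_inj; apply/seteqP; split=> -[U|c] //=.
- by move=> [cU Ut]; exact: tF.
- move=> FU; have cU := clopenF _ FU; split=> //.
  (* Otherwise [F] would contain both [U] and its complement. *)
  apply: contrapT => nUt; have FUC := tF _ (clopenC setT cU) nUt.
  by case: (far_compl U cU) => /far_notin.
- by move/(far_notin (far_cover c I)).
Qed.

Lemma range_trace_closed : closed (range trace).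
Proof.
rewrite range_trace; apply: closedI; [apply: closedI; [apply: closedI|]|];
  apply: closed_bigI => x _; try exact: far_closed.
- exact: (dist_fun_preimage_clopen X3 (inr x) [set r | r <= 1]).2.
- by apply: closedU; exact: far_closed.
Qed.

(** For a clopen [V] with [t] in [V] and [V] inside [U], the traces at distance below 1 from [V] are
    those of the points of [V]. *)
Lemma trace_open t (U : set T) : zero_dimensional_space T -> nbhs t U ->
  exists2 V, nbhs (trace t) V & trace @^-1` V `<=` U.
Proof.
move=> /zero_dimensional_spaceP zdT /zdT[V [cV Vt] VU].
exists (gdist (inl V) @^-1` [set r | r < 1]).
  apply: open_nbhs_nbhs; split.
    exact: (dist_fun_preimage_clopen X3 (inl V) [set r | r < 1]).1.
  by rewrite /preimage/= dist_trace_inl asboolT.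
move=> s; rewrite /preimage/= dist_trace_inl.
case: ifPn => [/asboolP[_ Vs] _|_]; first exact: VU.
by rewrite (ltr_nat R 2 1).
Qed.

Lemma trace_inj :
  accessible_space T -> zero_dimensional_space T -> injective trace.
Proof.
move=> T1 /zero_dimensional_spaceP zdT s t st; apply/eqP.
apply: contraT => /T1[A [oA /set_mem sA /set_mem tA]].
have [V [cV Vs] VA] := zdT s _ (open_nbhs_nbhs (conj oA sA)).
have : clopen_trace s (inl V) by [].
have -> : clopen_trace s = clopen_trace t by move/(congr1 val): st.
by move=> [_ /VA].
Qed.

End cover_graph.

Theorem theorem3p6 (R : realType) (T : topologicalType)
    (T1 : accessible_space T) :
  zero_dimensional_space T <->
  exists X : metricType R, three_valued X /\
    exists C : set (wijsman X), closed C /\ homeomorphic T (set_type C).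
Proof.
split=> [zdT|[X [X3 [C [_ TC]]]]].
  exists (cover_graph T : metricType R); split.
    exact: cover_graph_three_valued.
  exists (range (@trace R T)); split; first exact: range_trace_closed.
  apply: embedding_homeomorphic.
  - exact: trace_inj.
  - exact: trace_continuous.
  - by move=> t U; exact: trace_open.
apply: homeomorphic_zero_dimensional TC _.
exact/zero_dimensional_initial/zero_dimensional_wijsman.
Qed.
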